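(* Let $r\ge1$ be an integer, $\mathbf{a}=(a_1,\dots,a_{r+1})\in\mathbb{C}^{r+1}$, $\mathbf{b}=(b_1,\dots,b_r)\in\mathbb{C}^{r}$. Then for all integers $n\ge0$, whenever all terms are well defined (no denominator vanishes), $$(a_2-b_1)\frac{a_1(a_1-1)}{a_1+n-1}\;{}_{2r+2}F_{2r+1}\!\left(\begin{matrix}-n,\,2-b_1-n,\,1-\mathbf{b}_{[1]}-n,\,a_2,\,\mathbf{a}_{[2]}+1\\2-a_1-n,\,1-\mathbf{a}_{[1]}-n,\,\mathbf{b}+1\end{matrix}\right)$$ $$-(a_1-b_1)\frac{a_2(a_2-1)}{a_2+n-1}\;{}_{2r+2}F_{2r+1}\!\left(\begin{matrix}-n,\,2-b_1-n,\,1-\mathbf{b}_{[1]}-n,\,a_1,\,\mathbf{a}_{[1]}+1\\2-a_2-n,\,1-\mathbf{a}_{[2]}-n,\,\mathbf{b}+1\end{matrix}\right)$$ $$=(a_2-a_1)\frac{b_1(b_1-1)}{b_1+n-1}\;{}_{2r+2}F_{2r+1}\!\left(\begin{matrix}-n,\,1-\mathbf{b}-n,\,a_1,\,a_2,\,\mathbf{a}_{[1,2]}+1\\1-\mathbf{a}-n,\,b_1,\,\mathbf{b}_{[1]}+1\end{matrix}\right).$$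
   Context: ${}_{q+1}F_q$ denotes the generalized hypergeometric series $\sum_{k\ge0}\frac{\prod_i(u_i)_k}{\prod_i(v_i)_k\,k!}$ at unit argument, $(u)_k=u(u+1)\cdots(u+k-1)$; here each series terminates at $k=n$. $\mathbf{u}_{[k]}$ is $\mathbf{u}$ with the $k$-th component removed and $\mathbf{u}_{[1,2]}$ is $\mathbf{u}$ with the first two components removed. Vectors in parameter lists denote lists of their components, and operations with scalars are componentwise. *)

(* Defs.v *)
From HB Require Import structures.
From mathcomp Require Import all_boot all_order all_algebra.
From mathcomp Require Import all_classical all_reals all_analysis.
From mathcomp Require Export complex.

Set Implicit Arguments.
Unset Strict Implicit.
Unset Printing Implicit Defensive.

Import Order.TTheory GRing.Theory Num.Theory.
Import numFieldNormedType.Exports.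

Local Open Scope ring_scope.

Definition pochhammer (C : pzSemiRingType) (u : C) (k : nat) : C :=
  \prod_(i < k) (u + i%:R).

Definition hypergeom_num (C : pzSemiRingType) (us : seq C) (k : nat) : C :=
  \prod_(u <- us) pochhammer u k.

Definition hypergeom_den (C : pzSemiRingType) (vs : seq C) (k : nat) : C :=
  (\prod_(v <- vs) pochhammer v k) * k`!%:R.

(* The series at unit argument, as the limit of its partial sums for the usual
   topology of the complex numbers; the orders p = q + 1 and q are the sizes of
   [us] and [vs]. If -n occurs in [us], every term of index k > n has a zero
   numerator and hence is 0, even where its denominator vanishes, since
   0 / 0 = 0: the series terminates at k = n. *)
Definition hypergeom (R : realType) (us vs : seq R[i]) : R[i] :=
  limn (series (fun k : nat => hypergeom_num us k / hypergeom_den vs k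
                               : (R[i] : numFieldType)^o)).

(* No denominator vanishes in the terms k = 0, ..., n of a series which
   terminates at k = n. *)
Definition hypergeom_defined (C : nzSemiRingType) (n : nat) (vs : seq C) : Prop :=
  forall k : nat, (k <= n)%N -> hypergeom_den vs k != 0.

(* The list [s] with its item of index [k] removed, counting from 0 as [nth]
   does: the vector u_[k] of the usual 1-based notation is [omit k.-1 u]. *)
Definition omit (T : Type) (k : nat) (s : seq T) : seq T :=
  take k s ++ drop k.+1 s.

(* Main.v *)
Require Import Defs.
From mathcomp Require Import all_boot all_order all_algebra.
From mathcomp Require Import all_classical all_reals all_analysis.
From mathcomp Require Import ring.

Set Implicit Arguments.
Unset Strict Implicit.
Unset Printing Implicit Defensive.

Import Order.TTheory GRing.Theory Num.Theory.
Local Open Scope ring_scope.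

(* The k-th terms of the three series share a common factor [tail], and their
   combination in the theorem is [tail * kernel], where [kernel] involves only
   x = a_1, y = a_2, z = b_1.  The kernel vanishes at k = n.  Reversing
   Pochhammer symbols by (1 - u - n)_k (u)_(n-k) = (-1)^k (u)_n shows that, for
   k + l = n - 1, the product (-1)^k * tail k / (k + 1) is unchanged by swapping k and l,
   while (-1)^k * (k + 1) * kernel k changes sign.  So the terms k and n - 1 - k
   cancel. *)

Section Pochhammer.
Variable F : numFieldType.
Implicit Types (x y z : F) (s us vs : seq F) (k l m n : nat).

(** * Pochhammer symbols: shift, reflection, non-vanishing *)

Lemma pochhammerS x k : pochhammer x k.+1 = pochhammer x k * (x + k%:R).
Proof. by rewrite /pochhammer big_ord_recr. Qed.

Lemma pochhammer_shift x k : x * pochhammer (x + 1) k = pochhammer x k.+1.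
Proof.
rewrite /pochhammer big_ord_recl addr0; congr (_ * _).
by apply: eq_bigr => i _; rewrite /= /bump /= -addrA -natr1 [1 + _]addrC.
Qed.

Lemma pochhammer_add1 x k :
  x != 0 -> pochhammer (x + 1) k = pochhammer x k * (x + k%:R) / x.
Proof.
move=> x_nz; apply: (mulfI x_nz).
by rewrite pochhammer_shift pochhammerS mulrCA mulfV // mulr1.
Qed.

Lemma pochhammerD x m k :
  pochhammer x (m + k) = pochhammer x m * pochhammer (x + m%:R) k.
Proof.
rewrite /pochhammer big_split_ord; congr (_ * _).
by apply: eq_bigr => i _; rewrite /= natrD addrA.
Qed.

(** Split (x)_(k+m) as (x)_m (x+m)_k, then negate the k factors of (x+m)_k and read them
    backwards. *)
Lemma pochhammer_reflect x k m :
  pochhammer (1 - x - (k + m)%:R) k * pochhammer x m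
  = (-1) ^+ k * pochhammer x (k + m).
Proof.
rewrite addnC pochhammerD mulrCA mulrC; congr (_ * _).
have -> : (-1) ^+ k = \prod_(i < k) (-1) :> F by rewrite prodr_const card_ord.
rewrite /pochhammer (reindex_inj rev_ord_inj) -big_split /=.
apply: eq_bigr => i _; rewrite natrB // natrD -natr1; ring.
Qed.

Lemma pochhammer_neq0 x n :
  reflect (forall i, (i < n)%N -> x + i%:R != 0) (pochhammer x n != 0).
Proof.
apply: (iffP (prodf_neq0 _ _)) => /= H i; last by move=> _; exact: H.
by move=> lt_in; apply: (H (Ordinal lt_in)).
Qed.

Lemma pochhammer_neq0_le x k n :
  (k <= n)%N -> pochhammer x n != 0 -> pochhammer x k != 0.
Proof.
move=> le_kn /pochhammer_neq0 H; apply/pochhammer_neq0 => i lt_ik.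
by apply: H; apply: leq_trans le_kn.
Qed.

(** Lets a lower parameter 1 - x - n of a well-defined series yield that (x)_n is nonzero. *)
Lemma pochhammer_reflect_neq0 x n :
  (pochhammer (1 - x - n%:R) n != 0) = (pochhammer x n != 0).
Proof.
have := pochhammer_reflect x n 0; rewrite addn0 /pochhammer big_ord0 mulr1 => ->.
by rewrite mulf_eq0 signr_eq0.
Qed.

Lemma pochhammer_oppn n k : pochhammer (- n%:R : F) k = (-1) ^+ k * (n ^_ k)%:R.
Proof.
elim: k => [|k IH]; first by rewrite /pochhammer big_ord0 mulr1.
rewrite pochhammerS IH ffactnSr natrM exprSr.
(* Beyond k = n the truncated [n - k] is no longer the difference, but [n ^_ k] is then 0. *)
have [le_kn|lt_nk] := leqP k n; first by rewrite natrB //; ring.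
by rewrite ffact_small // !(mulr0, mul0r).
Qed.

Lemma hypergeom_defined_poch n vs :
  hypergeom_defined n vs -> {in vs, forall v, pochhammer v n != 0}.
Proof.
move=> /(_ n (leqnn n)); rewrite mulf_eq0 negb_or => /andP[+ _] v v_in.
by rewrite prodf_seq_neq0 => /allP /(_ v v_in).
Qed.

(** * The two factors of the combined k-th term *)

Definition poch_ratio n s k : F :=
  \prod_(x <- s) (pochhammer (1 - x - n%:R) k / pochhammer (x + 1) k).

(** With n = k + l + 1, 1 - x - n is 1 - (x+1) - (k+l), so by reflection each ratio at k is (-1)^k
    (x+1)_(k+l) / ((x+1)_k (x+1)_l). Apart from the sign this is symmetric, and the swap costs
    (-1)^(k+l) per entry of [s]. *)
Lemma poch_ratio_sym s k l :
  {in s, forall x, pochhammer (x + 1) (k + l) != 0} ->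
  poch_ratio (k + l).+1 s l = (-1) ^+ ((k + l) * size s) * poch_ratio (k + l).+1 s k.
Proof.
rewrite /poch_ratio; elim: s => [|x s IH] nz; first by rewrite !big_nil muln0 mulr1.
rewrite !big_cons IH => [|u u_s]; last by apply: nz; rewrite inE u_s orbT.
have x_nz : pochhammer (x + 1) (k + l) != 0 by apply: nz; rewrite inE eqxx.
have xk_nz := pochhammer_neq0_le (leq_addr l k) x_nz.
have xl_nz := pochhammer_neq0_le (leq_addl k l) x_nz.
have eq_arg : 1 - (x + 1) - (k + l)%:R = 1 - x - (k + l).+1%:R by rewrite -natr1; ring.
have refl_k := pochhammer_reflect (x + 1) k l.
have refl_l := pochhammer_reflect (x + 1) l k.
rewrite [(l + k)%N]addnC !eq_arg in refl_k refl_l.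
rewrite -(mulfK xl_nz (pochhammer _ k)) refl_k -(mulfK xk_nz (pochhammer _ l)) refl_l.
rewrite /= mulnS exprD exprD.
have := signr_eq0 F k; have := sqrr_sign F k.
move: ((-1) ^+ k) => sk sk2 sk_nz.
rewrite [LHS](_ : _ = sk ^+ 2 * (-1) ^+ l * (-1) ^+ ((k + l) * size s) *
  pochhammer (x + 1) (k + l) / pochhammer (x + 1) k / pochhammer (x + 1) l *
  \prod_(j <- s) (pochhammer (1 - j - (k + l).+1%:R) k / pochhammer (j + 1) k)).
  by ring.
by rewrite sk2; ring.
Qed.

(** Here [s] stands for a_3, a_4, ... and [t] for b_2, b_3, ... *)
Definition tail n s t k : F :=
  pochhammer (- n%:R) k / k`!%:R * (poch_ratio n t k / poch_ratio n s k).

Definition kernel n x y z k : F :=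
  let N := n%:R in
  (y - z) * (x * (x - 1) / (x + N - 1)) *
    (pochhammer (2 - z - N) k * pochhammer y k * pochhammer (x + 1) k /
     (pochhammer (2 - x - N) k * pochhammer (1 - y - N) k * pochhammer (z + 1) k))
  - (x - z) * (y * (y - 1) / (y + N - 1)) *
    (pochhammer (2 - z - N) k * pochhammer x k * pochhammer (y + 1) k /
     (pochhammer (2 - y - N) k * pochhammer (1 - x - N) k * pochhammer (z + 1) k))
  - (y - x) * (z * (z - 1) / (z + N - 1)) *
    (pochhammer (1 - z - N) k * pochhammer x k * pochhammer y k /
     (pochhammer (1 - x - N) k * pochhammer (1 - y - N) k * pochhammer z k)).

(** Reflection expresses every symbol through (u)_k, (u)_l and (u)_(k+l). The first factor is
    symmetric in k and l, so the final bracket alone decides what the swap does. *)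
Lemma kernelE k l x y z (n := (k + l).+1) :
  pochhammer x n != 0 -> pochhammer y n != 0 -> pochhammer z n != 0 ->
  (-1) ^+ k * kernel n x y z k =
    (z * (pochhammer x k * pochhammer x l / pochhammer x n)
       * (pochhammer y k * pochhammer y l / pochhammer y n)
       * (pochhammer z (k + l) / (pochhammer z k.+1 * pochhammer z l.+1))) *
    ((z + l%:R) * ((y - z) * (x - 1) * (x + k%:R) * (y + l%:R)
                 - (x - z) * (y - 1) * (y + k%:R) * (x + l%:R))
     - (y - x) * (z - 1) * (x + l%:R) * (y + l%:R) * (z + k%:R)).
Proof.
move=> x_nz y_nz z_nz.
have nz (u : F) i : pochhammer u n != 0 -> (i <= n)%N -> pochhammer u i != 0.
  by move=> u_nz le_in; exact: (pochhammer_neq0_le le_in u_nz).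
have nzl (u : F) i : pochhammer u n != 0 -> (i < n)%N -> u + i%:R != 0.
  by move=> u_nz; move/pochhammer_neq0: u_nz; apply.
have nz0 (u : F) : pochhammer u n != 0 -> u != 0 by move/nzl => /(_ 0)/[!addr0] ->.
have le_ln : (l < n)%N by rewrite ltnS leq_addl.
have le_kn : (k < n)%N by rewrite ltnS leq_addr.
have lt_kl : (k + l < n)%N by [].
(* Having 2 in place of 1 makes the symbol reflect at length k + l instead of n. *)
have arg2 (u : F) : 2 - u - n%:R = 1 - u - (k + l)%:R by rewrite /n -natr1; ring.
have refl2 (u : F) : pochhammer u n != 0 -> pochhammer (2 - u - n%:R) k
    = (-1) ^+ k * pochhammer u (k + l) / pochhammer u l.
  move=> u_nz; rewrite arg2 -pochhammer_reflect mulfK //.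
  by apply: nz => //; exact: ltnW.
have refl1 (u : F) : pochhammer u n != 0 -> pochhammer (1 - u - n%:R) k
    = (-1) ^+ k * (pochhammer u (k + l) * (u + (k + l)%:R))
      / (pochhammer u l * (u + l%:R)).
  move=> u_nz; rewrite -!pochhammerS -addnS -pochhammer_reflect addnS mulfK //.
  exact: nz.
have step (u : F) : pochhammer u n != 0 -> pochhammer (u + 1) k = pochhammer u k * (u + k%:R) / u.
  by move=> u_nz; exact: (pochhammer_add1 k (nz0 u u_nz)).
have nat1 : n%:R = (k + l)%:R + 1 :> F by rewrite /n -natr1.
rewrite /kernel !refl1 // !refl2 // !step // !pochhammerS -/n.
(* Each fraction of the kernel carries the sign once above and twice below. With the sign on the
   right also written as an inverse, the identity holds for any nonzero [sk], which suits
   [field]. *)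
apply: (canLR (signrMK k)); rewrite -[X in _ = X * _]invr_sign {refl1 refl2 step arg2}.
have := (nz0 x x_nz, nz0 y y_nz, nz0 z z_nz).
have := (nzl x l x_nz le_ln, nzl y l y_nz le_ln, nzl z l z_nz le_ln).
have := (nzl x k x_nz le_kn, nzl y k y_nz le_kn, nzl z k z_nz le_kn).
have := (nzl x _ x_nz lt_kl, nzl y _ y_nz lt_kl, nzl z _ z_nz lt_kl).
have := (nz x l x_nz (ltnW le_ln), nz y l y_nz (ltnW le_ln), nz z l z_nz (ltnW le_ln)).
have := (nz x k x_nz (ltnW le_kn), nz y k y_nz (ltnW le_kn), nz z k z_nz (ltnW le_kn)).
have := (nz x _ x_nz (ltnW lt_kl), nz y _ y_nz (ltnW lt_kl), nz z _ z_nz (ltnW lt_kl)).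
rewrite nat1 natrD.
move: (pochhammer x k) (pochhammer x l) (pochhammer x (k + l)).
move: (pochhammer y k) (pochhammer y l) (pochhammer y (k + l)).
move: (pochhammer z k) (pochhammer z l) (pochhammer z (k + l)).
have : (-1) ^+ k != 0 :> F by rewrite signr_eq0.
move: ((-1) ^+ k) => sk sk_nz zk zl zkl yk yl ykl xk xl xkl.
have subN1 (u : F) : u + (k%:R + l%:R + 1) - 1 = u + (k%:R + l%:R) by ring.
rewrite !{}subN1.
move: (k%:R : F) (l%:R : F) => K L.
do 7! move=> [[? ?] ?].
by field; do ?[apply/andP; split].
Qed.

(** The bracket in [kernelE] is l + 1 times a polynomial that changes sign when k and l are
    swapped. *)
Lemma kernel_antisym k l x y z (n := (k + l).+1) :
  pochhammer x n != 0 -> pochhammer y n != 0 -> pochhammer z n != 0 ->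
  k.+1%:R * ((-1) ^+ k * kernel n x y z k)
  = - (l.+1%:R * ((-1) ^+ l * kernel n x y z l)).
Proof.
move=> x_nz y_nz z_nz; have := @kernelE l k x y z.
rewrite [(l + k)%N]addnC kernelE // => -> //.
rewrite -!natr1 !invfM; ring.
Qed.

(** The index k = n has no partner. Reflection leaves a multiple of (y-z)(x+n) - (x-z)(y+n) -
    (y-x)(z+n), which is identically zero. *)
Lemma kernel_top n x y z :
  pochhammer x n != 0 -> pochhammer y n != 0 -> pochhammer z n != 0 ->
  pochhammer (x - 1) n.+1 != 0 -> pochhammer (y - 1) n.+1 != 0 ->
  z + n%:R - 1 != 0 -> pochhammer (z + 1) n != 0 -> kernel n x y z n = 0.
Proof.
move=> x_nz y_nz z_nz x1_nz y1_nz zn_nz z1_nz.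
have refl (u : F) : pochhammer (1 - u - n%:R) n = (-1) ^+ n * pochhammer u n.
  have := pochhammer_reflect u n 0.
  by rewrite addn0 [pochhammer u 0]/pochhammer big_ord0 mulr1.
have down (u : F) : u + n%:R - 1 != 0 ->
    pochhammer (u - 1) n = (u - 1) * pochhammer u n / (u + n%:R - 1).
  move=> un_nz; have := pochhammer_shift (u - 1) n.
  by rewrite subrK pochhammerS addrAC => ->; rewrite mulfK.
have top_nz (u : F) : pochhammer (u - 1) n.+1 != 0 -> (u + n%:R - 1 != 0) && (u - 1 != 0).
  move/pochhammer_neq0 => H; rewrite -[in X in X && _]addrAC H //=.
  by have := H 0 isT; rewrite addr0.
(* At n = 0 all symbols are 1 and say nothing about x, y, z; for n > 0 they give the nonzero x, y, z
   that [pochhammer_add1] requires. *)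
case: n => [|n] in x_nz y_nz z_nz x1_nz y1_nz zn_nz z1_nz refl down top_nz *.
  move: x1_nz y1_nz zn_nz => /top_nz/andP[_ ?] /top_nz/andP[_ ?].
  rewrite /kernel /pochhammer !big_ord0 addr0 => ?; field.
  by do ?[apply/andP; split].
have nz0 (u : F) : pochhammer u n.+1 != 0 -> u != 0.
  by move/pochhammer_neq0 => /(_ 0 isT); rewrite addr0.
have arg2 (u : F) : 2 - u - n.+1%:R = 1 - (u - 1) - n.+1%:R by ring.
have [/andP[xn_nz x1] /andP[yn_nz y1]] := (top_nz x x1_nz, top_nz y y1_nz).
have [x0 y0 z0] := And3 (nz0 x x_nz) (nz0 y y_nz) (nz0 z z_nz).
have zS_nz : z + n.+1%:R != 0.
  by move/pochhammer_neq0: z1_nz => /(_ n (ltnSn n)); rewrite -addrA nat1r.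
rewrite /kernel !arg2 !refl !down // !pochhammer_add1 //.
have : (-1) ^+ n.+1 != 0 :> F by rewrite signr_eq0.
move: ((-1) ^+ n.+1) => sn sn_nz.
move: (pochhammer x _) x_nz (pochhammer y _) y_nz (pochhammer z _) z_nz.
move=> px px_nz py py_nz pz pz_nz.
move: (n.+1%:R : F) xn_nz yn_nz zn_nz zS_nz => N *.
by field; do ?[apply/andP; split].
Qed.

(** The number (-1)^k (-n)_k / k! is the binomial n! / (k! (l+1)!), symmetric once multiplied by l +
    1. The signs from [poch_ratio_sym] cancel because [s] and [t] have equal length. *)
Lemma tail_sym k l s t (n := (k + l).+1) : size s = size t ->
  {in s, forall x, pochhammer (x + 1) (k + l) != 0} ->
  {in t, forall x, pochhammer (x + 1) (k + l) != 0} ->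
  ((-1) ^+ l * tail n s t l) * k.+1%:R = ((-1) ^+ k * tail n s t k) * l.+1%:R.
Proof.
move=> eq_st s_nz t_nz; rewrite /tail !poch_ratio_sym // eq_st.
have fact_nz i : i`!%:R != 0 :> F by rewrite pnatr_eq0 -lt0n fact_gt0.
have binE i j : (i + j)%N = (k + l)%N -> (-1) ^+ i * (pochhammer (- n%:R) i / i`!%:R)
  = n`!%:R / (i`!%:R * j.+1`!%:R) :> F.
  move=> eq_ij; have le_in : (i <= n)%N by rewrite /n -eq_ij -addnS leq_addr.
  rewrite pochhammer_oppn -mulrA signrMK -(ffact_fact le_in) natrM.
  have -> : (n - i)%N = j.+1 by rewrite /n -eq_ij -addnS addKn.
  by rewrite -mulf_div divff // mulr1.
rewrite !(mulrA (_ ^+ _) (_ / _)) (binE l k) ?[(l + k)%N]addnC // (binE k l) //.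
rewrite -mulf_div mulrA divff ?signr_eq0 // mul1r !factS !natrM.
move: (_ / poch_ratio _ _ _) => c.
have := fact_nz k; have := fact_nz l.
have : l.+1%:R != 0 :> F by rewrite pnatr_eq0.
have : k.+1%:R != 0 :> F by rewrite pnatr_eq0.
move: (k.+1%:R : F) (l.+1%:R : F) (k`!%:R : F) (l`!%:R : F) (n`!%:R : F) => *.
by field; do ?[apply/andP; split].
Qed.

Lemma sum_tail_kernel n s t x y z : size s = size t ->
  {in s, forall u, pochhammer u n != 0} ->
  {in t, forall u, pochhammer (u + 1) n != 0} ->
  pochhammer x n != 0 -> pochhammer y n != 0 -> pochhammer z n != 0 ->
  pochhammer (x - 1) n.+1 != 0 -> pochhammer (y - 1) n.+1 != 0 ->
  z + n%:R - 1 != 0 -> pochhammer (z + 1) n != 0 ->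
  \sum_(k < n.+1) tail n s t k * kernel n x y z k = 0.
Proof.
move=> eq_st s_nz t_nz x_nz y_nz z_nz x1_nz y1_nz zn_nz z1_nz.
rewrite big_ord_recr /= kernel_top // mulr0 addr0.
(* Reversing the summation pairs k with l = n - 1 - k and gives S = - S, hence S = 0 in
   characteristic 0. *)
set S := \sum_(i < n) _; suff : S = - S by move/eqP; rewrite -addr_eq0 -mulr2n mulrn_eq0 => /eqP.
rewrite {1}/S (reindex_inj rev_ord_inj) -sumrN /=; apply: eq_bigr => k _.
have [l nE] : exists l, n = (k + l).+1.
  by exists (n - k.+1)%N; rewrite -addSn subnKC.
have -> : (n - k.+1)%N = l by rewrite {1}nE -addSn addKn.
move: (nat_of_ord k) nE => {S}j nE; subst n.
have anti := kernel_antisym x_nz y_nz z_nz.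
have sym : ((-1) ^+ l * tail (j + l).+1 s t l) * j.+1%:R = ((-1) ^+ j * tail (j + l).+1 s t j) * l.+1%:R.
  apply: tail_sym => // u u_in.
    have := s_nz u u_in; rewrite -pochhammer_shift mulf_eq0 negb_or.
    by case/andP.
  exact: pochhammer_neq0_le (leqnSn _) (t_nz u u_in).
have j_nz : j.+1%:R != 0 :> F by rewrite pnatr_eq0.
have l_nz : l.+1%:R != 0 :> F by rewrite pnatr_eq0.
apply: (mulIf j_nz); apply: (mulIf l_nz).
(* Inserting the sign twice brings both factors to the shape of [sym] and [anti]. *)
have prodE i : tail (j + l).+1 s t i * kernel (j + l).+1 x y z i =
    ((-1) ^+ i * tail (j + l).+1 s t i) * ((-1) ^+ i * kernel (j + l).+1 x y z i).
  by rewrite mulrACA -expr2 sqrr_sign mul1r.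
rewrite !prodE.
move: (_ * tail _ _ _ l) (_ * tail _ _ _ j) sym => Al Aj sym.
move: (_ * kernel _ _ _ _ l) (_ * kernel _ _ _ _ j) anti => Bl Bj anti.
transitivity (- (Al * j.+1%:R) * (- (l.+1%:R * Bl))); first by ring.
by rewrite -anti sym; ring.
Qed.

End Pochhammer.

(** * Terminating series and the final identity *)

Lemma hypergeom_sum (R : realType) n (us vs : seq R[i]) : - n%:R \in us ->
  hypergeom us vs = \sum_(k < n.+1) hypergeom_num us k / hypergeom_den vs k.
Proof.
(* The partial sums are constant from length n + 1 on, since (-n)_k = 0 for k > n. *)
move=> n_us; rewrite /hypergeom; apply: (@lim_near_cst ((R[i] : numFieldType)^o : ptopologicalType)).
  exact: norm_hausdorff.
near=> m; rewrite /series /= (big_cat_nat (n := n.+1)) //=; last by near: m; exact: nbhs_infty_ge.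
rewrite big_mkord [X in _ + X]big_nat_cond [X in _ + X]big1 ?addr0 // => k /andP[/andP[lt_nk _] _].
rewrite /hypergeom_num (big_rem _ n_us) /= pochhammer_oppn ffact_small //.
by rewrite !(mulr0, mul0r).
Unshelve. all: by end_near.
Qed.

Theorem theorem6p7 (R : realType) (r : nat) (hr : (1 <= r)%N)
    (a : (r.+1).-tuple R[i]) (b : r.-tuple R[i]) (n : nat) :
  let N : R[i] := n%:R in
  let a1 := a`_0 in
  let a2 := a`_1 in
  let b1 := b`_0 in
  let upper1 := [:: - N, 2 - b1 - N & [seq 1 - x - N | x <- omit 0 b]]
                ++ a2 :: [seq x + 1 | x <- omit 1 a] in
  let lower1 := (2 - a1 - N) :: [seq 1 - x - N | x <- omit 0 a]
                ++ [seq x + 1 | x <- b] in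
  let upper2 := [:: - N, 2 - b1 - N & [seq 1 - x - N | x <- omit 0 b]]
                ++ a1 :: [seq x + 1 | x <- omit 0 a] in
  let lower2 := (2 - a2 - N) :: [seq 1 - x - N | x <- omit 1 a]
                ++ [seq x + 1 | x <- b] in
  let upper3 := (- N) :: [seq 1 - x - N | x <- b]
                ++ [:: a1, a2 & [seq x + 1 | x <- drop 2 a]] in
  let lower3 := [seq 1 - x - N | x <- a]
                ++ b1 :: [seq x + 1 | x <- omit 0 b] in
  a1 + N - 1 != 0 -> a2 + N - 1 != 0 -> b1 + N - 1 != 0 ->
  hypergeom_defined n lower1 ->
  hypergeom_defined n lower2 ->
  hypergeom_defined n lower3 ->
  (a2 - b1) * (a1 * (a1 - 1) / (a1 + N - 1)) * hypergeom upper1 lower1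
  - (a1 - b1) * (a2 * (a2 - 1) / (a2 + N - 1)) * hypergeom upper2 lower2
  = (a2 - a1) * (b1 * (b1 - 1) / (b1 + N - 1)) * hypergeom upper3 lower3.
Proof.
case: r hr a b => // r _ a b N.
(* From here a is [x :: y :: s] and b is [z :: t]. *)
case: a => -[|x [|y s]] // a_size; case: b => -[|z t] // b_size.
rewrite /omit /= !drop0 => xN_nz yN_nz zN_nz def1 def2 def3.
have eq_st : size s = size t by move: a_size b_size => /eqP[->] /eqP[->].
have {}def1 := hypergeom_defined_poch def1.
have {}def2 := hypergeom_defined_poch def2.
have {}def3 := hypergeom_defined_poch def3.
(* The symbol (2-u-n)_n reflects to (u-1)_n; the one further factor of (u-1)_(n+1) is u + n - 1, the
   denominator of a prefactor. *)
have sub1_nz (u : R[i]) : u + N - 1 != 0 -> pochhammer (2 - u - N) n != 0 ->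
    pochhammer (u - 1) n.+1 != 0.
  rewrite (_ : 2 - u - N = 1 - (u - 1) - N); last by ring.
  by rewrite pochhammer_reflect_neq0 pochhammerS mulf_eq0 negb_or addrAC => -> ->.
have sum0 : \sum_(k < n.+1) tail n s t k * kernel n x y z k = 0.
  apply: sum_tail_kernel => //.
  - move=> u u_s; rewrite -pochhammer_reflect_neq0; apply: def3.
    have /= u_in := map_f (fun v => 1 - v - N) u_s.
    by rewrite !(inE, mem_cat) u_in !orbT.
  - move=> u u_t; apply: def1; have /= u_in := map_f (fun v => v + 1) u_t.
    by rewrite !(inE, mem_cat) u_in !orbT.
  - by rewrite -pochhammer_reflect_neq0; apply: def3; rewrite !inE eqxx.
  - by rewrite -pochhammer_reflect_neq0; apply: def3; rewrite !inE eqxx orbT.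
  - by apply: def3; rewrite !(inE, mem_cat) eqxx !orbT.
  - by apply: sub1_nz => //; apply: def1; rewrite !inE eqxx.
  - by apply: sub1_nz => //; apply: def2; rewrite !inE eqxx.
  - by apply: def1; rewrite !(inE, mem_cat) eqxx !orbT.
rewrite !(hypergeom_sum (n := n)) ?inE ?eqxx //.
apply: subr0_eq; rewrite -[RHS]sum0 !mulr_sumr -!sumrB.
apply: eq_bigr => k _; rewrite /tail /kernel -/N /poch_ratio !prodf_div.
rewrite /hypergeom_num /hypergeom_den !(big_cons, big_cat, big_map) /=.
(* Once inverses are distributed, both sides are the same polynomial in the symbols and their
   inverses. *)
rewrite !invfM !invrK; ring.
Qed.
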